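(* Let $\{P_n(\eta)\}$ be a family of classical orthogonal polynomials with sinusoidal coordinate $\eta(x)$, governing operator $\widetilde{\mathcal H}$ and eigenvalues $\mathcal{E}(n)$, so that $\widetilde{\mathcal H}P_n(\eta(x))=\mathcal{E}(n)P_n(\eta(x))$. Fix a positive integer $\mathcal{N}$ (with $\mathcal{N}<N$ if the family is defined on a finite lattice $\{0,1,\ldots,N\}$), let $\eta(x_1),\ldots,\eta(x_{\mathcal N})$ be the zeros of $P_{\mathcal N}$, and define the $\mathcal{N}\times\mathcal{N}$ matrix $\mathcal{M}$ by $$\mathcal{M}_{n\,m}=-\frac{\dot{\eta}(x_m)\left.\left(\bigl(\widetilde{\mathcal H}-\mathcal{E}(\mathcal{N})\bigr)\prod_{j\neq m}\bigl(\eta(x)-\eta(x_j)\bigr)\right)\right|_{x=x_n}}{\dot{\eta}(x_n)\prod_{j\neq n}\bigl(\eta(x_n)-\eta(x_j)\bigr)},\qquad n,m=1,\ldots,\mathcal{N},$$ where $j$ runs over $\{1,\ldots,\mathcal{N}\}$ in the products. Then the eigenvalues of $\mathcal{M}$ are $$\mathcal{E}(\mathcal{N})-\mathcal{E}(m),\qquad m=0,1,\ldots,\mathcal{N}-1.$$ (They thus depend on the parameters of $\widetilde{\mathcal H}$, through the numbers $\mathcal{E}(n)$, but not directly on the zeros $\eta(x_n)$.)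
   Context: Setting. A family of classical orthogonal polynomials consists of the following data. $\eta(x)$ is a function of one variable $x$ (the sinusoidal coordinate; in the examples $x$, $x^2$, $x(x+d)$, $\cos x$, $\cos 2x$, $q^{-x}-1$, $1-q^x$, or $(q^{-x}-1)(1-Aq^x)$), with $\dot\eta(x)=d\eta(x)/dx$. For each $n$, $P_n(\eta)$ is a polynomial of degree exactly $n$ in $\eta$, where $n=0,1,2,\ldots$, or $n=0,1,\ldots,N$ for families on a finite lattice. The $P_n(\eta(x))$ are orthogonal with respect to a positive weight $\phi_0(x)^2$ on an interval of $x$ or, in the discrete case, on the lattice $\{0,1,\ldots,N\}$ or $\{0,1,2,\ldots\}$; they satisfy a three-term recurrence relation. There is a second order linear differential or difference operator $\widetilde{\mathcal H}$ acting on functions of $x$ and numbers $\mathcal{E}(n)$ with $$\widetilde{\mathcal H}P_n(\eta(x))=\mathcal{E}(n)P_n(\eta(x)),$$ understood as an identity between analytic functions of $x$. The operator $\widetilde{\mathcal H}=\phi_0(x)^{-1}\circ\mathcal{H}\circ\phi_0(x)$ is the similarity transform of a one-dimensional exactly solvable Hamiltonian $\mathcal{H}$ with eigenfunctions $\phi_0(x)P_n(\eta(x))$ and eigenvalues $\mathcal{E}(n)$, which are pairwise distinct. It is of one of three types: (i) a second order differential operator in $x$; (ii) $\widetilde{\mathcal H}=V(x)(e^{-i\gamma\partial_x}-1)+V^*(x)(e^{i\gamma\partial_x}-1)$, with $\gamma$ real and nonzero, $e^{\pm i\gamma\partial_x}\psi(x)=\psi(x\pm i\gamma)$, $V$ an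 analytic function, and $V^*$ obtained from $V$ by complex conjugating its power series coefficients; (iii) $\widetilde{\mathcal H}=B(x)(1-e^{\partial})+D(x)(1-e^{-\partial})$, with $e^{\pm\partial}\psi(x)=\psi(x\pm1)$, $B,D\ge0$ on the lattice, $D(0)=0$, and $B(N)=0$ in the finite lattice case. Consequently $\widetilde{\mathcal H}$ maps a polynomial in $\eta(x)$ of degree at most $n$ to a polynomial in $\eta(x)$ of degree at most $n$; expressions $(\widetilde{\mathcal H}Q(\eta(x)))|_{x=x_n}$ are evaluations of this resulting polynomial. The zeros of $P_{\mathcal N}$ are real and simple, being those of an orthogonal polynomial; they are written $\eta(x_1),\ldots,\eta(x_{\mathcal N})$, with points $x_n$ such that $\dot\eta(x_n)\neq0$. Empty products equal $1$. *)

(* Defs.v *)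
From mathcomp Require Import all_boot all_order all_algebra complex.
From mathcomp Require Import all_classical all_reals all_analysis.

Set Implicit Arguments.
Unset Strict Implicit.
Unset Printing Implicit Defensive.

Import Order.TTheory GRing.Theory Num.Theory numFieldNormedType.Exports.

Local Open Scope classical_set_scope.
Local Open Scope ring_scope.

(* R[i], packaged as a numClosedFieldType so that it receives the canonical
   topology of a numFieldType; [derivable f z 1] and [derive1 f] for
   f : Cplx R -> Cplx R are then the complex notions. *)
Definition Cplx (R : realType) : numClosedFieldType := R[i].

Definition toC (R : realType) (x : R) : Cplx R := (x%:C)%C.

(* p.[z] for a real polynomial p and a complex number z. *)
Definition polyC_of (R : realType) (p : {poly R}) : {poly Cplx R} :=
  map_poly (@toC R) p.

(* Analyticity on an open set D, as existence of all complex derivatives. *)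
Definition analytic_on (R : realType) (D : set (Cplx R))
    (f : Cplx R -> Cplx R) : Prop :=
  forall (k : nat) (z : Cplx R), D z -> derivable (derive1n k f) z 1.

(* V^*: if V z = \sum_k c_k (z - x0)^k with x0 real, then
   conj_coef V z = \sum_k (c_k)^* (z - x0)^k. *)
Definition conj_coef (R : realType) (V : Cplx R -> Cplx R) (z : Cplx R) :
  Cplx R := (V z^*)^*.

(* The type of the operator, together with the physical range of x:
   DiffOp J a b c      a d^2/dx^2 + b d/dx + c, x in the interval J;
   ImShiftOp J g V     V (e^{-i g d} - 1) + V^* (e^{i g d} - 1), x in J;
   ReShiftOp L B D     B (1 - e^d) + D (1 - e^{-d}), x in {0, .., N} if
                       L = Some N, and in {0, 1, 2, ..} if L = None. *)
Variant governing (R : realType) : Type :=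
| DiffOp of interval R & (Cplx R -> Cplx R) & (Cplx R -> Cplx R)
    & (Cplx R -> Cplx R)
| ImShiftOp of interval R & R & (Cplx R -> Cplx R)
| ReShiftOp of option nat & (Cplx R -> Cplx R) & (Cplx R -> Cplx R).

Definition apply_op (R : realType) (g : governing R)
    (f : Cplx R -> Cplx R) (x : Cplx R) : Cplx R :=
  match g with
  | DiffOp _ a b c => a x * derive1n 2 f x + b x * derive1 f x + c x * f x
  | ImShiftOp _ gam V =>
      V x * (f (x - 'i * toC gam) - f x)
      + conj_coef V x * (f (x + 'i * toC gam) - f x)
  | ReShiftOp _ B D => B x * (f x - f (x + 1)) + D x * (f x - f (x - 1))
  end.

Definition in_lattice (L : option nat) (k : nat) : bool :=
  if L is Some N then (k <= N)%N else true.

Definition phys_range (R : realType) (g : governing R) : set R :=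
  match g with
  | DiffOp J _ _ _ => [set` J]
  | ImShiftOp J _ _ => [set` J]
  | ReShiftOp L _ _ => [set x | exists2 k : nat, in_lattice L k & x = k%:R]
  end.

Definition admissible_degree (R : realType) (g : governing R) (n : nat) :
  bool := if g is ReShiftOp L _ _ then in_lattice L n else true.

Definition below_lattice_size (R : realType) (g : governing R) (n : nat) :
  Prop := if g is ReShiftOp (Some N) _ _ then (n < N)%N else True.

(* [op_conditions g edom dom]: edom is where the sinusoidal coordinate is
   analytic, dom is where the operator is considered. *)
Definition op_conditions (R : realType) (g : governing R)
    (edom dom : set (Cplx R)) : Prop :=
  match g with
  | DiffOp _ a b c =>
      [/\ analytic_on dom a, analytic_on dom b, analytic_on dom c
        & exists2 z, dom z & a z != 0]
  | ImShiftOp _ gam V =>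
      [/\ gam != 0, analytic_on dom V, analytic_on dom (conj_coef V)
        & forall z, dom z ->
            edom (z - 'i * toC gam) /\ edom (z + 'i * toC gam)]
  | ReShiftOp L B D =>
      [/\ analytic_on dom B /\ analytic_on dom D,
          forall z, dom z -> edom (z + 1) /\ edom (z - 1),
          forall k : nat, in_lattice L k -> 0 <= B k%:R /\ 0 <= D k%:R,
          D 0 = 0
        & forall N : nat, L = Some N -> B N%:R = 0]
  end.

(* [pairing g f v]: the integral (or sum) of f over the physical range exists
   and equals v. *)
Definition pairing (R : realType) (g : governing R) (f : R -> R) (v : R) :
  Prop :=
  let int_over (J : interval R) :=
    (@lebesgue_measure R).-integrable [set` J] (EFin \o f)
    /\ (\int[@lebesgue_measure R]_(x in [set` J]) (f x)%:E = v%:E)%E in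
  match g with
  | DiffOp J _ _ _ => int_over J
  | ImShiftOp J _ _ => int_over J
  | ReShiftOp (Some N) _ _ => \sum_(k < N.+1) f k%:R = v
  | ReShiftOp None _ _ => series (fun k : nat => f k%:R) @ \oo --> v
  end.

(* eta x as a real number; used only for x in the physical range, where eta
   takes real values (axiom cop_eta_real). *)
Definition real_eta (R : realType) (eta : Cplx R -> Cplx R) (x : R) : R :=
  complex.Re (eta (toC x)).

(* Degrees n range over the n with [admissible_degree cop_op n]. *)
Record cop_family (R : realType) : Type := CopFamily {
  cop_eta : Cplx R -> Cplx R;
  cop_edom : set (Cplx R);
  cop_dom : set (Cplx R);
  cop_op : governing R;
  cop_P : nat -> {poly R};
  cop_E : nat -> R;
  cop_phi0 : R -> R;
  cop_norm : nat -> R;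
  cop_H : (R -> R) -> R -> R;

  cop_edom_open : open cop_edom;
  cop_edom_connected : connected cop_edom;
  cop_eta_analytic : analytic_on cop_edom cop_eta;
  cop_dom_open : open cop_dom;
  cop_dom_connected : connected cop_dom;
  cop_dom_sub : cop_dom `<=` cop_edom;
  cop_range_sub : forall x, phys_range cop_op x -> cop_dom (toC x);
  cop_op_conditions : op_conditions cop_op cop_edom cop_dom;
  cop_eta_real : forall x, phys_range cop_op x ->
    cop_eta (toC x) = toC (real_eta cop_eta x);

  cop_degree : forall n, admissible_degree cop_op n -> size (cop_P n) = n.+1;
  cop_weight_gt0 : forall x, phys_range cop_op x -> 0 < cop_phi0 x ^+ 2;
  cop_norm_gt0 : forall n, admissible_degree cop_op n -> 0 < cop_norm n;
  cop_orthogonal : forall n m,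
    admissible_degree cop_op n -> admissible_degree cop_op m ->
    pairing cop_op
      (fun x => cop_phi0 x ^+ 2 * (cop_P n).[real_eta cop_eta x]
                * (cop_P m).[real_eta cop_eta x])
      (if n == m then cop_norm n else 0);
  cop_three_term : forall n, admissible_degree cop_op n.+1 ->
    exists a b c : R,
      'X * cop_P n = a *: cop_P n.+1 + b *: cop_P n
                     + (if n is n'.+1 then c *: cop_P n' else 0);

  cop_eigen : forall n, admissible_degree cop_op n ->
    forall z, cop_dom z ->
      apply_op cop_op (fun w => (polyC_of (cop_P n)).[cop_eta w]) z
      = toC (cop_E n) * (polyC_of (cop_P n)).[cop_eta z];
  cop_E_inj : forall n m,
    admissible_degree cop_op n -> admissible_degree cop_op m ->
    cop_E n = cop_E m -> n = m;

  (* cop_H is the Hamiltonian H = phi0 o H~ o phi0^{-1}, acting on the wave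
     functions phi0 * Q(eta) over the physical range. *)
  cop_similarity : forall (Q : {poly R}) x, phys_range cop_op x ->
    toC (cop_H (fun y => cop_phi0 y * Q.[real_eta cop_eta y]) x)
    = toC (cop_phi0 x)
      * apply_op cop_op (fun w => (polyC_of Q).[cop_eta w]) (toC x);
  cop_H_symmetric : forall (Q1 Q2 : {poly R}) (v : R),
    let psi1 y := cop_phi0 y * Q1.[real_eta cop_eta y] in
    let psi2 y := cop_phi0 y * Q2.[real_eta cop_eta y] in
    pairing cop_op (fun x => cop_H psi1 x * psi2 x) v
    <-> pairing cop_op (fun x => psi1 x * cop_H psi2 x) v;
  cop_H_eigen : forall n, admissible_degree cop_op n ->
    let psi y := cop_phi0 y * (cop_P n).[real_eta cop_eta y] in
    forall x, phys_range cop_op x -> cop_H psi x = cop_E n * psi x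
}.

(* The polynomial S, of degree at most that of Q, such that
   H~ (Q(eta(x))) = S(eta(x)). *)
Definition op_poly (R : realType) (F : cop_family R) (Q : {poly Cplx R}) :
  {poly Cplx R} :=
  xget 0 [set S : {poly Cplx R} | (size S <= size Q)%N /\
    forall z, cop_dom F z ->
      apply_op (cop_op F) (fun w => Q.[cop_eta F w]) z = S.[cop_eta F z]].

Definition zeros_prod (R : realType) (F : cop_family R) (N : nat)
    (x : 'I_N -> Cplx R) (m : 'I_N) : {poly Cplx R} :=
  \prod_(j < N | j != m) ('X - (cop_eta F (x j))%:P).

Definition Mmat (R : realType) (F : cop_family R) (N : nat)
    (x : 'I_N -> Cplx R) : 'M[Cplx R]_N :=
  let eta := cop_eta F in
  \matrix_(n < N, m < N)
    - ((derive1 eta (x m)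
        * (op_poly F (zeros_prod F x m)
           - toC (cop_E F N) *: zeros_prod F x m).[eta (x n)])
       / (derive1 eta (x n)
          * \prod_(j < N | j != n) (eta (x n) - eta (x j)))).

(* Main.v *)
(** Being orthogonal with positive norms, the functions P_k(eta(x)), k < N, are
    linearly independent on the domain of the operator. Hence the polynomial
    representing H~ Q(eta(x)), for Q = sum_k q_k P_k, can only be
    sum_k q_k E(k) P_k; no identity theorem for eta is needed. Up to the
    diagonal conjugation by eta'(x_n), the matrix M is then E(N) - H~ acting on
    polynomials of degree < N, written in the Lagrange basis attached to the
    zeros; in the basis P_0, .., P_(N-1) it is diagonal. *)
Require Import Defs.
From mathcomp Require Import all_boot all_order all_algebra complex.
From mathcomp Require Import all_classical all_reals all_analysis.
From mathcomp Require Import ring zify.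

Set Implicit Arguments.
Unset Strict Implicit.
Unset Printing Implicit Defensive.

Import Order.TTheory GRing.Theory Num.Theory numFieldNormedType.Exports.
Local Open Scope ring_scope.

(** Elimination from the top degree: subtracting the multiple of [f n] that matches the coefficient
    of degree [n] lowers the size. *)
Lemma triangular_poly_span (K : fieldType) (f : nat -> {poly K}) (n : nat) :
  (forall k, (k < n)%N -> size (f k) = k.+1) ->
  forall Q : {poly K}, (size Q <= n)%N ->
  exists q : nat -> K, Q = \sum_(k < n) q k *: f k.
Proof.
elim: n => [|n IHn] sf Q sQ.
  by exists (fun=> 0); rewrite big_ord0; apply/eqP; rewrite -size_poly_leq0.
pose c := Q`_n / (f n)`_n.
have fn0 : (f n)`_n != 0.
  have := sf n (ltnSn n) => sfn; have := lead_coef_eq0 (f n).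
  by rewrite lead_coefE sfn /= -size_poly_eq0 sfn => ->.
have sQ' : (size (Q - c *: f n)%R <= n)%N.
  apply/leq_sizeP => j; rewrite leq_eqVlt => /predU1P[<-|nj].
    by rewrite coefB coefZ /c divfK // subrr.
  rewrite coefB coefZ !nth_default ?mulr0 ?subr0 // ?sf //.
  exact: leq_trans sQ nj.
have [q eq] := IHn (fun k kn => sf k (ltnW kn)) _ sQ'.
exists (fun k => if k == n then c else q k).
rewrite big_ord_recr /= eqxx -[LHS](subrK (c *: f n)) eq; congr (_ + _).
by apply: eq_bigr => k _; rewrite ltn_eqF.
Qed.

(** Linearity of the pairing in all its forms: it carries a pointwise linear relation on the
    physical range over to the values. *)
Lemma pairing_sum_eq0 (R : realType) (g : governing R) (n : nat)
    (f : 'I_n -> R -> R) (v c : 'I_n -> R) :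
  (forall k, pairing g (f k) (v k)) ->
  (forall x, phys_range g x -> \sum_(k < n) c k * f k x = 0) ->
  \sum_(k < n) c k * v k = 0.
Proof.
have int_case (J : interval R) :
    (forall k, (@lebesgue_measure R).-integrable [set` J] (EFin \o f k)
      /\ (\int[@lebesgue_measure R]_(x in [set` J]) (f k x)%:E = (v k)%:E)%E) ->
    (forall x, [set` J]%classic x -> \sum_(k < n) c k * f k x = 0) ->
    \sum_(k < n) c k * v k = 0.
  move=> fv f0; have mJ : measurable [set` J] by exact: measurable_itv.
  pose h (k : 'I_n) (x : R) : \bar R := ((c k)%:E * (f k x)%:E)%E.
  have ih k : (@lebesgue_measure R).-integrable [set` J] (h k).
    by apply: integrableZl => //; have [] := fv k.
  apply: EFin_inj.
  transitivity (\int[@lebesgue_measure R]_(x in [set` J])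
      (\sum_(k < n) h k x)%R)%E; last first.
    apply: integral0_eq => x Jx; rewrite /h.
    by under eq_bigr do rewrite -EFinM; rewrite sumEFin f0.
  rewrite integral_sum // -sumEFin; apply: eq_bigr => k _.
  have [ifk vk] := fv k.
  by rewrite /h integralZl // EFinM vk.
case: g => [J a b d|J gam V|[L|] B D] /=.
- exact: int_case.
- exact: int_case.
- move=> fv f0; under eq_bigr do rewrite -fv mulr_sumr.
  rewrite exchange_big big1 // => k _; apply: f0.
  by exists k => //=; rewrite -ltnS.
(* On the infinite lattice the same sequence of combined partial sums tends to the claimed sum and
   is identically 0; limits are unique. *)
- move=> fv f0.
  have cv : ((\sum_(k < n) c k * series (fun j : nat => f k j%:R) i)
      @[i --> \oo] --> \sum_(k < n) c k * v k)%classic.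
    apply: cvg_big => [|k _]; first exact: add_continuous.
    by apply: cvgMl_tmp; apply: fv.
  have cv0 : ((\sum_(k < n) c k * series (fun j : nat => f k j%:R) i)
      @[i --> \oo] --> (0 : R))%classic.
    rewrite (_ : (fun _ => _) = cst 0); first exact: cvg_cst.
    apply/funext => i /=; rewrite /series /=.
    under eq_bigr do rewrite mulr_sumr.
    by rewrite exchange_big big1 // => k _; apply: f0; exists k.
  by apply: (cvg_unique _ cv cv0).
Qed.

(** * Linearity of the operator on polynomials in the sinusoidal coordinate *)

Lemma is_derive_poly_comp (K : numFieldType) (eta : K -> K) (z : K)
    (p : {poly K}) :
  derivable eta z 1 ->
  is_derive z 1 (fun w => p.[eta w]) (p^`().[eta z] * derive1 eta z).
Proof.
move=> deta; have {}deta : is_derive z 1 eta (derive1 eta z).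
  by rewrite derive1E; apply/derivableP.
elim/poly_ind: p => [|p c IHp].
  rewrite (_ : (fun w => _) = cst 0); last by apply/funext => w; rewrite horner0.
  by rewrite deriv0 horner0 mul0r; exact: is_derive_cst.
rewrite (_ : (fun w => _) = (fun w => p.[eta w]) * eta + cst c); last first.
  by apply/funext => w; rewrite !hornerE.
apply: is_derive_eq.
by rewrite derivD derivM derivX derivC !hornerE /GRing.scale /=; ring.
Qed.

Lemma derive1_poly_comp (K : numFieldType) (eta : K -> K) (z : K)
    (p : {poly K}) :
  derivable eta z 1 ->
  derive1 (fun w => p.[eta w]) z = p^`().[eta z] * derive1 eta z.
Proof.
move=> /(is_derive_poly_comp p) dp.
by rewrite derive1E (@derive_val _ _ _ _ _ _ _ dp).
Qed.

Lemma derive2_poly_comp (K : numFieldType) (eta : K -> K) (z : K)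
    (p : {poly K}) :
  (\near z, derivable eta z 1) -> derivable (derive1 eta) z 1 ->
  derive1 (derive1 (fun w => p.[eta w])) z
  = p^`(2).[eta z] * derive1 eta z ^+ 2
    + p^`().[eta z] * derive1 (derive1 eta) z.
Proof.
move=> deta ddeta; rewrite derive1E.
(* The chain rule formula for the first derivative must hold on a neighbourhood of [z] before it can
   be differentiated again. *)
rewrite (@near_eq_derive _ _ _ _
  ((fun w => p^`().[eta w]) * derive1 eta)); last first.
  by near=> w; apply: derive1_poly_comp; near: w.
have dp := is_derive_poly_comp p^`() (nbhs_singleton deta).
have {}ddeta : is_derive z 1 (derive1 eta) (derive1 (derive1 eta) z).
  by rewrite derive1E; apply/derivableP.
rewrite (@derive_val _ _ _ _ _ _ _ (is_deriveM dp ddeta)) derivnS derivn1.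
by rewrite /GRing.scale /=; ring.
Unshelve. all: by end_near.
Qed.

(** [derive1] is a total function, linear only where derivatives exist; the chain rule reduces the
    claim to linearity of formal derivatives. *)
Lemma diff_op_poly_comp_linear (K : numFieldType) (eta : K -> K)
    (z a2 a1 a0 c : K) (p q : {poly K}) :
  let L r := a2 * derive1 (derive1 (fun w => r.[eta w])) z
             + a1 * derive1 (fun w => r.[eta w]) z + a0 * r.[eta z] in
  (\near z, derivable eta z 1) -> derivable (derive1 eta) z 1 ->
  L (c *: p + q) = c * L p + L q.
Proof.
move=> L deta ddeta; rewrite /L !derive2_poly_comp //.
rewrite !(derive1_poly_comp _ (nbhs_singleton deta)).
by rewrite !derivnS !derivn0 !derivD !derivZ !(hornerD, hornerZ); ring.
Qed.

Lemma apply_op_poly_sum (R : realType) (F : cop_family R) (n : nat)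
    (c : 'I_n -> Cplx R) (p : 'I_n -> {poly Cplx R}) (z : Cplx R) :
  cop_dom F z ->
  apply_op (cop_op F) (fun w => (\sum_(k < n) c k *: p k).[cop_eta F w]) z
  = \sum_(k < n) c k * apply_op (cop_op F) (fun w => (p k).[cop_eta F w]) z.
Proof.
move=> domz.
have eta_near : \near z, derivable (cop_eta F) z 1.
  have edomz := cop_dom_sub domz.
  near=> w; apply: (@cop_eta_analytic _ F 0%N); near: w.
  by apply: open_nbhs_nbhs; split => //; exact: cop_edom_open.
have ddeta : derivable (derive1 (cop_eta F)) z 1.
  exact: (@cop_eta_analytic _ F 1%N) (cop_dom_sub domz).
pose A q := apply_op (cop_op F) (fun w => q.[cop_eta F w]) z.
have A_lin (a : Cplx R) p1 p2 : A (a *: p1 + p2) = a * A p1 + A p2.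
  rewrite /A; case: (cop_op F) => [J a2 a1 a0|J gam V|L B E] /=.
  - exact: diff_op_poly_comp_linear.
  - by rewrite !(hornerD, hornerZ); ring.
  - by rewrite !(hornerD, hornerZ); ring.
(* Writing 0 as [-1 *: 0 + 0] gives [A 0 = - A 0 + A 0]. *)
have A0 : A 0 = 0 by rewrite -[0](addNr 0) -scaleN1r A_lin mulN1r addNr.
rewrite -/(A _); elim/big_rec2: _ => // k _ s _ <-.
exact: A_lin.
Unshelve. all: by end_near.
Qed.

(** [eigenvalue] refers to row vectors: [v] is an eigenvector of the product exactly when [v *m W]
    is one of the diagonal matrix. *)
Lemma eigenvalue_diag_conj (K : fieldType) (n : nat) (W Q : 'M[K]_n)
    (d : 'rV[K]_n) (a : K) :
  W *m Q = 1%:M ->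
  eigenvalue (W *m diag_mx d *m Q) a <-> exists k, a = d 0 k.
Proof.
move=> WQ; have QW := mulmx1C WQ; split.
  move=> /eigenvalueP[v va v0].
  have : v *m W != 0.
    by apply: contraNneq v0 => vW0; rewrite -[v]mulmx1 -WQ mulmxA vW0 mul0mx.
  move=> /rV0Pn[k uk]; exists k; apply: (mulIf uk).
  have : v *m W *m diag_mx d = a *: (v *m W).
    by rewrite -[LHS]mulmx1 -QW scalemxAl -va !mulmxA.
  by move=> /rowP/(_ k); rewrite mul_mx_diag !mxE mulrC => ->.
(* Conversely, row [k] of [Q] is an eigenvector for the entry [d 0 k]. *)
move=> [k ->]; apply/eigenvalueP; exists (delta_mx 0 k *m Q).
  rewrite !mulmxA -[_ *m Q *m W]mulmxA QW mulmx1 scalemxAl; congr (_ *m Q).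
  apply/rowP => j; rewrite mul_mx_diag !mxE eqxx /=.
  by case: eqP => [->|_]; rewrite ?mul1r ?mulr1 ?mul0r ?mulr0.
apply/eqP => dQ0; have /matrixP/(_ 0 k) : delta_mx 0 k = 0 :> 'rV[K]_n.
  by rewrite -[LHS]mulmx1 -QW mulmxA dQ0 mul0mx.
by rewrite !mxE !eqxx => /eqP; rewrite oner_eq0.
Qed.

(* Expanding the cardinal polynomials [l m] in the eigenbasis [p] writes the
   matrix as W D Q, with D diagonal and W Q = 1 because [l m] vanishes at the
   nodes other than [y m]. *)
Lemma eigenvalue_interpolation_matrix (K : fieldType) (N : nat)
    (p l : 'I_N -> {poly K}) (q : 'I_N -> 'I_N -> K) (y d e : 'I_N -> K)
    (s a : K) :
  (forall n, d n != 0) -> (forall n, (l n).[y n] != 0) ->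
  (forall m n, m != n -> (l m).[y n] = 0) ->
  (forall m, l m = \sum_(k < N) q m k *: p k) ->
  eigenvalue (\matrix_(n < N, m < N)
    - ((d m * (\sum_(k < N) (q m k * e k) *: p k - s *: l m).[y n])
       / (d n * (l n).[y n]))) a
  <-> exists k, a = s - e k.
Proof.
move=> d0 l_diag l_off ql; set M := \matrix_(n, m) _.
pose W := \matrix_(n < N, k < N) ((p k).[y n] / (d n * (l n).[y n])).
pose Q := \matrix_(k < N, m < N) (d m * q m k).
pose D := \row_(k < N) (s - e k).
have WQ : W *m Q = 1%:M.
  apply/matrixP => n m; rewrite !mxE.
  transitivity (d m * (l m).[y n] / (d n * (l n).[y n])).
    rewrite (ql m) horner_sum mulr_sumr mulr_suml.
    by apply: eq_bigr => k _; rewrite !mxE hornerZ; ring.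
  have [->|nm] := eqVneq n m; first by rewrite divff // mulf_neq0.
  by rewrite l_off 1?eq_sym // mulr0 mul0r.
have -> : M = W *m diag_mx D *m Q.
  apply/matrixP => n m; rewrite mul_mx_diag !mxE.
  rewrite (ql m) hornerD hornerN hornerZ !horner_sum !mulr_sumr -sumrB.
  rewrite mulr_sumr mulr_suml -sumrN.
  by apply: eq_bigr => k _; rewrite !mxE !hornerZ; ring.
rewrite (eigenvalue_diag_conj D a WQ).
by split=> -[k ->]; exists k; rewrite mxE.
Qed.

(** * Uniqueness of the polynomial representing the operator, and the eigenvalues *)

Lemma horner_polyC_of (R : realType) (p : {poly R}) (y : R) :
  (polyC_of p).[toC y] = toC p.[y].
Proof. exact: (horner_map (real_complex R)). Qed.

Lemma size_polyC_of (R : realType) (p : {poly R}) :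
  size (polyC_of p) = size p.
Proof. exact: (size_map_poly (real_complex R)). Qed.

(** Pairing the relation with [cop_P F k] leaves only [t k] times a positive norm. *)
Lemma cop_P_eta_free (R : realType) (F : cop_family R) (n : nat)
    (t : 'I_n -> Cplx R) :
  (forall k : 'I_n, admissible_degree (cop_op F) k) ->
  (forall z, cop_dom F z ->
     \sum_(k < n) t k * (polyC_of (cop_P F k)).[cop_eta F z] = 0) ->
  forall k, t k = 0.
Proof.
move=> adm t0 k.
(* Orthogonality is a real statement while the [t k] are complex, so [r] stands for the real or the
   imaginary part; both are linear over [R]. *)
have part (r : Cplx R -> R) :
    (forall u y s, r (u * toC y + s) = r u * y + r s) -> r 0 = 0 ->
    r (t k) = 0.
  move=> rD r0; apply: (mulIf (lt0r_neq0 (cop_norm_gt0 (adm k)))).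
  rewrite mul0r.
  have := @pairing_sum_eq0 _ _ _ _ _ (fun j => r (t j))
    (fun j : 'I_n => cop_orthogonal (adm j) (adm k)).
  rewrite (bigD1 k) //= eqxx big1 ?addr0; last first.
    by move=> j jk; rewrite ifN ?mulr0.
  apply=> x rx.
  set y := real_eta (cop_eta F) x.
  have : \sum_(j < n) r (t j) * (cop_P F j).[y] = 0.
    rewrite -[RHS]r0 -[X in r X](t0 _ (cop_range_sub rx)).
    rewrite (cop_eta_real rx); elim/big_rec2: _ => // j s s' _ ->.
    by rewrite horner_polyC_of rD.
  move=> /(congr1 (fun s => cop_phi0 F x ^+ 2 * (cop_P F k).[y] * s)).
  rewrite mulr0 mulr_sumr => E; rewrite -[RHS]E.
  by apply: eq_bigr => j _; ring.
have Re0 : complex.Re (t k) = 0.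
  apply: part => // -[u1 u2] y [s1 s2] /=.
  by rewrite mulr0 subr0.
have Im0 : complex.Im (t k) = 0.
  apply: part => // -[u1 u2] y [s1 s2] /=.
  by rewrite mulr0 add0r.
by apply/eqP; rewrite eq_complex Re0 Im0 !eqxx.
Qed.

(** [op_poly] is an arbitrary choice among the polynomials meeting its specification, so the sum
    must be shown to meet it and to be the only one that does. *)
Lemma op_polyE (R : realType) (F : cop_family R) (n : nat)
    (q : 'I_n -> Cplx R) (Q : {poly Cplx R}) :
  (forall k : 'I_n, admissible_degree (cop_op F) k) ->
  size Q = n -> Q = \sum_(k < n) q k *: polyC_of (cop_P F k) ->
  op_poly F Q
  = \sum_(k < n) (q k * toC (cop_E F k)) *: polyC_of (cop_P F k).
Proof.
move=> adm sQ eQ.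
have HQ z : cop_dom F z -> apply_op (cop_op F) (fun w => Q.[cop_eta F w]) z =
    (\sum_(k < n) (q k * toC (cop_E F k)) *: polyC_of (cop_P F k)).[cop_eta F z].
  move=> domz; rewrite eQ apply_op_poly_sum // horner_sum.
  by apply: eq_bigr => k _; rewrite cop_eigen // hornerZ mulrA.
rewrite /op_poly; set T := [set S | _]%classic.
set S0 := \sum_(k < n) _.
(* The default value 0 of [xget] is excluded because [S0] itself meets the specification. *)
have [S ->{S} [sS HS]|/(_ S0)] := xgetP; last first.
  case; split=> //; rewrite sQ; apply: (leq_trans (size_sum _ _ _)).
  apply/bigmax_leqP => k _; apply: (leq_trans (size_scale_leq _ _)).
  by rewrite size_polyC_of cop_degree.
rewrite sQ in sS.
have szP k : (k < n)%N -> size (polyC_of (cop_P F k)) = k.+1.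
  by move=> kn; rewrite size_polyC_of cop_degree //; exact: (adm (Ordinal kn)).
(* The size bound places [S] in the span of the same [n] polynomials, so agreement on the domain
   forces equal coefficients. *)
have [s eS] := triangular_poly_span szP sS; rewrite eS /S0.
apply: eq_bigr => k _; congr (_ *: _); apply/eqP; rewrite -subr_eq0; apply/eqP.
apply: (@cop_P_eta_free _ F n (fun k => s k - q k * toC (cop_E F k)) adm).
move=> z domz; have := HS z domz; rewrite HQ // eS !horner_sum => /eqP.
rewrite eq_sym -subr_eq0 -sumrB => /eqP E; rewrite -[RHS]E.
by apply: eq_bigr => {}k _; rewrite !hornerZ mulrBl.
Qed.

Theorem theorem3p1 (R : realType) (F : cop_family R) (N : nat)
    (N_gt0 : (0 < N)%N) (N_lt : below_lattice_size (cop_op F) N)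
    (x : 'I_N -> Cplx R)
    (x_dom : forall n : 'I_N, cop_edom F (x n))
    (x_dot : forall n : 'I_N, derive1 (cop_eta F) (x n) != 0)
    (x_simple : injective (fun n : 'I_N => cop_eta F (x n)))
    (x_zeros : forall z : Cplx R,
       root (polyC_of (cop_P F N)) z <-> exists n : 'I_N, z = cop_eta F (x n)) :
  forall a : Cplx R,
    eigenvalue (Mmat F x) a <->
    exists m : 'I_N, a = toC (cop_E F N - cop_E F m).
Proof.
move=> a.
have adm (k : 'I_N) : admissible_degree (cop_op F) k.
  move: N_lt; case: (cop_op F) => [//|//|[L|] B D] //= NL.
  exact: ltnW (ltn_trans (ltn_ord k) NL).
pose p k := polyC_of (cop_P F k).
have szp k : (k < N)%N -> size (p k) = k.+1.
  by move=> kN; rewrite size_polyC_of cop_degree //; exact: (adm (Ordinal kN)).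
pose l := zeros_prod F x.
(* A product of [N - 1] linear factors has size exactly [N], as [op_polyE] requires. *)
have szl m : size (l m) = N.
  rewrite /l /zeros_prod size_prod; last by move=> j _; rewrite polyXsubC_eq0.
  under eq_bigr do rewrite size_XsubC.
  rewrite sum_nat_const cardC1 card_ord; lia.
have l_eval m n : (l m).[cop_eta F (x n)]
    = \prod_(j < N | j != m) (cop_eta F (x n) - cop_eta F (x j)).
  by rewrite /l /zeros_prod horner_prod; under eq_bigr do rewrite hornerXsubC.
have l_diag n : (l n).[cop_eta F (x n)] != 0.
  rewrite l_eval; apply/prodf_neq0 => j jn.
  by rewrite subr_eq0; apply: contra_neq jn => /x_simple.
have l_off m n : m != n -> (l m).[cop_eta F (x n)] = 0.
  by move=> mn; rewrite l_eval (bigD1 n) 1?eq_sym //= subrr mul0r.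
have /choice[q ql] : forall m, exists q : nat -> Cplx R,
    l m = \sum_(k < N) q k *: p k.
  by move=> m; apply: triangular_poly_span; rewrite ?szl.
(* Each cardinal polynomial has an expansion in the [p k], on which the operator multiplies
   coefficients by eigenvalues; the products in the denominators are the values [l n] takes at its
   own node. *)
have -> : Mmat F x = \matrix_(n < N, m < N)
    - ((derive1 (cop_eta F) (x m)
        * (\sum_(k < N) (q m k * toC (cop_E F k)) *: p k
           - toC (cop_E F N) *: l m).[cop_eta F (x n)])
       / (derive1 (cop_eta F) (x n) * (l n).[cop_eta F (x n)])).
  by apply/matrixP => n m; rewrite !mxE -l_eval -(op_polyE adm (szl m) (ql m)).
have toCB (u v : R) : toC u - toC v = toC (u - v) by rewrite /toC rmorphB.
rewrite (eigenvalue_interpolation_matrix _ _ _ x_dot l_diag l_off ql).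
by split=> -[k ->]; exists k; rewrite toCB.
Qed.
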